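(* For all $\rho \in (0,1]$, $d \in \mathbb{N}$, and all sufficiently large $T$, there exist $\rho$-zCDP mechanisms $\mathcal{M}, \mathcal{M}'$ in the adaptive continual release model such that $\mathcal{M}$ is $(\alpha,T)$-accurate for $\mathrm{MaxSum}_d$ and $\mathcal{M}'$ is $(\alpha,T)$-accurate for $\mathrm{SumSelect}_d$, where $\alpha = O\Big(\frac{\sqrt{d}\, \log T \sqrt{\log(dT)}}{\sqrt{\rho}}\Big)$.
   Context: Records lie in $\mathcal{X}=\{0,1\}^d$; $\vec x_{[t]}=(x_1,\dots,x_t)$. $\mathrm{MaxSum}_d(\vec x_{[t]})=\max_j\sum_{i\le t}x_i[j]$ with error $|\mathrm{MaxSum}_d(\vec x_{[t]})-a|$; $\mathrm{SumSelect}_d(\vec x_{[t]})$ is an index attaining the maximum, with error of $a\in[d]$ equal to $\mathrm{MaxSum}_d(\vec x_{[t]})-\sum_{i\le t}x_i[a]$. Adaptive continual release model: a mechanism $\mathcal{M}$ interacts for $T$ steps with an adversary (an arbitrary randomized process with no computational restrictions that does not see $\mathcal{M}$'s coins); at each step the adversary chooses the next record $x_t$ based on the previous records and previous outputs $a_1,\dots,a_{t-1}$, and $\mathcal{M}$ outputs $a_t$. $\mathcal{M}$ is $(\alpha,T)$-accurate for $f$ if for every adversary, $\Pr_{\text{coins of }\mathcal{M},\text{adversary}}[\max_{t\in[T]}\mathrm{err}_f(\vec x_{[t]},a_t)\le\alpha]\ge 2/3$. Privacy game with hidden bit $\mathrm{side}\in\{L,R\}$: for $t=1,\dots,T$, the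 adversary declares step $t$ regular or challenge (challenge exactly once, at a step $t^*$ of its choice); at a regular step it outputs $x_t$, which is sent to $\mathcal{M}$; at the challenge step it outputs a pair $(x^{(L)}_{t^*},x^{(R)}_{t^*})$ and $x^{(\mathrm{side})}_{t^*}$ is sent to $\mathcal{M}$; then $\mathcal{M}$'s output $a_t$ is given to the adversary. The view $V^{(\mathrm{side})}$ is the adversary's internal randomness together with the transcript of messages it sends and receives. $\mathcal{M}$ is $\rho$-zCDP if for every adversary and every $\xi\in(1,\infty)$, $D_\xi(V^{(L)}\|V^{(R)})\le\xi\rho$ and $D_\xi(V^{(R)}\|V^{(L)})\le\xi\rho$, where $D_\xi(Q\|Q')=\frac1{\xi-1}\log\mathbb{E}_{r\sim Q'}[(Q(r)/Q'(r))^{\xi}]$ is the Rényi divergence of order $\xi$. *)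

(* Defs.v *)
From HB Require Import structures.
From mathcomp Require Import all_boot all_order all_algebra.
From mathcomp Require Import all_classical all_reals all_analysis.

Set Implicit Arguments.
Unset Strict Implicit.
Unset Printing Implicit Defensive.

Import Order.TTheory GRing.Theory Num.Theory.
Import numFieldNormedType.Exports.

Local Open Scope classical_set_scope.
Local Open Scope ring_scope.

#[short(type="finPointedType")]
HB.structure Definition FinPointed := {T of isPointed T & Finite T}.

HB.instance Definition _ n := isPointed.Build 'I_n.+1 ord0.

(* An alias, because the library gives tuples the product sigma-algebra. *)
Definition discrete (T : Type) : Type := T.

HB.instance Definition _ (T : finPointedType) := FinPointed.on (discrete T).
HB.instance Definition _ (T : finPointedType) :=
  @isMeasurable.Build default_measure_display (discrete T)
    discrete_measurable discrete_measurable0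
    discrete_measurableC discrete_measurableU.

Definition record (d : nat) : Type := d.-tuple bool.
HB.instance Definition _ d := Finite.on (record d).
HB.instance Definition _ d := Pointed.on (record d).

Definition colsum d (xs : seq (record d)) (j : 'I_d) : nat :=
  (\sum_(x <- xs) tnth x j)%N.

Definition MaxSum d (xs : seq (record d)) : nat := (\max_(j < d) colsum xs j)%N.

Definition err_MaxSum (R : realType) d (xs : seq (record d)) (a : R) : R :=
  `|(MaxSum xs)%:R - a|.

Definition err_SumSelect (R : realType) d (xs : seq (record d))
    (a : discrete 'I_d) : R :=
  (MaxSum xs)%:R - (colsum xs a)%:R.

(* All coins are drawn in advance, so the output a_t is a function of the coins
   and of x_1, ..., x_t; the earlier outputs are determined by these. *)
Record mechanism (R : realType) (X : Type) dA (A : measurableType dA) :=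
  Mechanism {
    mech_display : measure_display;
    mech_coins : measurableType mech_display;
    mech_prob : probability mech_coins R;
    mech_out : mech_coins -> seq X -> A;
    measurable_mech_out : forall xs : seq X,
      measurable_fun [set: mech_coins] (mech_out ^~ xs) }.

(* The next message is a function of the adversary's coins and of the list of
   earlier rounds (message sent, answer received), oldest first. *)
Record adversary (R : realType) (M : finPointedType) dA (A : measurableType dA) :=
  Adversary {
    adv_display : measure_display;
    adv_coins : measurableType adv_display;
    adv_prob : probability adv_coins R;
    adv_next : adv_coins -> seq (discrete M * A) -> discrete M;
    measurable_adv_next : forall n : nat,
      measurable_fun [set: adv_coins * n.-tuple (discrete M * A)]
        (fun wh => adv_next wh.1 wh.2) }.

Arguments measurable_mech_out {R X dA A} m xs.
Arguments measurable_adv_next {R M dA A} a n.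

(* [play next ans n] lists the first n rounds when all coins are fixed. *)
Fixpoint play (M A : Type) (next : seq (M * A) -> M) (ans : seq M -> A)
    (n : nat) : seq (M * A) :=
  if n is n'.+1 then
    let h := play next ans n' in
    let m := next h in
    rcons h (m, ans (rcons (unzip1 h) m))
  else [::].

Lemma size_play M A (next : seq (M * A) -> M) (ans : seq M -> A) n :
  size (play next ans n) == n.
Proof. by elim: n => //= n /eqP IH; rewrite size_rcons IH. Qed.

Definition play_tuple M A (next : seq (M * A) -> M) (ans : seq M -> A) n :
  n.-tuple (M * A) := Tuple (size_play next ans n).

Lemma tnth_rcons_lift S n (t : n.-tuple S) x j :
  tnth [tuple of rcons t x] (lift ord_max j) = tnth t j.
Proof.
by rewrite !(tnth_nth x) lift_max /= nth_rcons size_tuple ltn_ord.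
Qed.

Lemma tnth_rcons_max S n (t : n.-tuple S) x :
  tnth [tuple of rcons t x] ord_max = x.
Proof. by rewrite (tnth_nth x) /= nth_rcons size_tuple ltnn eqxx. Qed.

Section Interaction.
Context (R : realType) (X : Type) (M : finPointedType).
Context dA (A : measurableType dA).
(* [sent m] is the record handed to the mechanism when the adversary's message
   is m *)
Variable sent : M -> X.
Variables (Mech : mechanism R X A) (Adv : adversary R M A) (T : nat).

Local Notation coins := (mech_coins Mech * adv_coins Adv)%type.

Definition transcript (n : nat) (w : coins) : n.-tuple (discrete M * A) :=
  play_tuple (adv_next w.2) (fun ms => mech_out w.1 (map sent ms)) n.

Definition view (w : coins) :
    (adv_coins Adv * T.-tuple (discrete M * A))%type :=
  (w.2, transcript T w).

Lemma measurable_finite_case d1 (T1 : measurableType d1) d2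
    (T2 : measurableType d2) (K : finType) (key : T1 -> K) (g : K -> T1 -> T2) :
  (forall k, measurable [set x | key x = k]) ->
  (forall k, measurable_fun [set: T1] (g k)) ->
  measurable_fun [set: T1] (fun x => g (key x) x).
Proof.
move=> mkey mg _ B mB; rewrite setTI.
have -> : (fun x => g (key x) x) @^-1` B =
    \bigcup_(k in [set: K]) ([set x | key x = k] `&` (g k @^-1` B)).
  apply/seteqP; split=> [x /= Bx|x [k _ [/= -> //]]].
  by exists (key x).
apply: fin_bigcup_measurable => [|k _]; first exact: finite_finset.
apply: measurableI => //.
by rewrite -[_ @^-1` _]setTI; exact: mg.
Qed.

Lemma measurable_transcript n : measurable_fun [set: coins] (transcript n).
Proof.
elim: n => [|n IH]; first by apply/measurable_fun_tnthP => -[].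
pose m (w : coins) : discrete M := adv_next w.2 (transcript n w).
have mm : measurable_fun [set: coins] m.
  have mh : measurable_fun [set: coins] (fun w => (w.2, transcript n w)).
    exact: measurable_fun_pair.
  exact: (measurableT_comp (measurable_adv_next Adv n) mh).
pose ms (w : coins) : n.+1.-tuple M :=
  [tuple of rcons (map_tuple fst (transcript n w)) (m w)].
pose a (w : coins) : A := mech_out w.1 (map sent (ms w)).
have mmsg (i : 'I_n) : measurable_fun [set: coins]
    (fun w => (tnth (transcript n w) i).1).
  apply: measurableT_comp => //.
  by apply: (measurableT_comp (measurable_tnth i)).
have ma : measurable_fun [set: coins] a.
  apply: (@measurable_finite_case _ _ _ _ (n.+1.-tuple M) ms
    (fun k w => mech_out w.1 (map sent k))) => [k|k]; last first.
    exact: (measurableT_comp (measurable_mech_out Mech (map sent k))).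
  have -> : [set w | ms w = k] =
      \bigcap_(i in [set: 'I_n.+1]) [set w | tnth (ms w) i = tnth k i].
    apply/seteqP; split=> [w /= <- i _ //|w /= H].
    by apply: eq_from_tnth => i; exact: H.
  apply: fin_bigcap_measurable => [|i _]; first exact: finite_finset.
  have [j ->|->] := unliftP ord_max i.
    have -> : [set w | tnth (ms w) (lift ord_max j) = tnth k (lift ord_max j)] =
        (fun w => (tnth (transcript n w) j).1) @^-1` [set tnth k (lift ord_max j)].
      by apply/seteqP; split=> w /=; rewrite tnth_rcons_lift tnth_map.
    by rewrite -[_ @^-1` _]setTI; exact: mmsg.
  have -> : [set w | tnth (ms w) ord_max = tnth k ord_max] =
      m @^-1` [set tnth k ord_max].
    by apply/seteqP; split=> w /=; rewrite tnth_rcons_max.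
  by rewrite -[_ @^-1` _]setTI; exact: mm.
have -> : transcript n.+1 = fun w => [tuple of rcons (transcript n w) (m w, a w)].
  by apply/funext => w; apply: val_inj.
apply/measurable_fun_tnthP => i.
have [j ->|->] := unliftP ord_max i.
  rewrite (_ : _ \o _ = fun w => tnth (transcript n w) j).
    by apply: (measurableT_comp (measurable_tnth j)).
  by apply/funext => w /=; rewrite tnth_rcons_lift.
rewrite (_ : _ \o _ = fun w => (m w, a w)); first exact: measurable_fun_pair.
by apply/funext => w /=; rewrite tnth_rcons_max.
Qed.

Lemma measurable_view : measurable_fun [set: coins] view.
Proof.
by apply: measurable_fun_pair; [exact: measurable_snd|exact: measurable_transcript].
Qed.

HB.instance Definition _ := isMeasurableFun.Build _ _ _ _ view measurable_view.

Definition view_law :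
    probability (adv_coins Adv * T.-tuple (discrete M * A))%type R :=
  distribution (mech_prob Mech \x adv_prob Adv)%E view.

End Interaction.
Arguments transcript {R X M dA A} sent Mech Adv n w.
Arguments view {R X M dA A} sent Mech Adv T w.

(* The adversary sends the records themselves; [x_[t+1]] and [a_(t+1)] are read
   off the transcript for [t < T]. *)
Definition accurate (R : realType) d dA (A : measurableType dA)
    (err : seq (record d) -> A -> R) (T : nat) (alpha : R)
    (Mech : mechanism R (record d) A) : Prop :=
  forall Adv : adversary R (record d) A,
    ((2 / 3)%:E <= (mech_prob Mech \x adv_prob Adv)
      [set w | let h := transcript id Mech Adv T w in
        (\big[Num.max/0]_(t < T)
           err (take t.+1 (unzip1 h)) (tnth h t).2 <= alpha)%R])%E.

Inductive message (X : Type) : Type :=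
| Regular of X
| Challenge of X & X.

Definition message_code X (m : message X) : X + X * X :=
  match m with Regular x => inl x | Challenge xL xR => inr (xL, xR) end.

Definition message_decode X (c : X + X * X) : message X :=
  match c with inl x => Regular x | inr xs => Challenge xs.1 xs.2 end.

Lemma message_codeK X : cancel (@message_code X) (@message_decode X).
Proof. by case. Qed.

HB.instance Definition _ (X : finPointedType) :=
  Finite.copy (message X) (can_type (@message_codeK X)).
HB.instance Definition _ (X : finPointedType) :=
  isPointed.Build (message X) (Regular point).

Definition is_challenge X (m : message X) : bool :=
  if m is Challenge _ _ then true else false.

Inductive side := SideL | SideR.

Definition sent_on X (s : side) (m : message X) : X :=
  match m with
  | Regular x => x
  | Challenge xL xR => match s with SideL => xL | SideR => xR end
  end.

(* Exactly one of the T messages is a challenge, whatever the coins and however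
   the messages are answered. *)
Definition one_challenge (R : realType) (X : finPointedType)
    dA (A : measurableType dA) (T : nat) (Adv : adversary R (message X) A) :=
  forall (w : adv_coins Adv) (ans : seq (discrete (message X)) -> A),
    count (@is_challenge X) (unzip1 (play (adv_next w) ans T)) = 1%N.

(* Q(r)/Q'(r) is the Radon-Nikodym derivative; the divergence is infinite when
   Q is not absolutely continuous with respect to Q'. *)
Definition renyi_divergence (R : realType) d (V : measurableType d) (xi : R)
    (Q Q' : probability V R) : \bar R :=
  if pselect (Q `<< Q') then
    ((xi - 1)^-1%:E * lne (\int[Q']_r
       poweR (Radon_Nikodym (charge_of_finite_measure Q) Q' r) xi))%E
  else +oo%E.

Definition zCDP (R : realType) (X : finPointedType) dA (A : measurableType dA)
    (T : nat) (rho : R) (Mech : mechanism R X A) : Prop :=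
  forall Adv : adversary R (message X) A, one_challenge T Adv ->
    let VL := view_law (sent_on SideL) Mech Adv T in
    let VR := view_law (sent_on SideR) Mech Adv T in
    forall xi : R, 1 < xi ->
      (renyi_divergence xi VL VR <= (xi * rho)%:E)%E /\
      (renyi_divergence xi VR VL <= (xi * rho)%:E)%E.

(* Main.v *)
Require Import Defs.
From HB Require Import structures.
From mathcomp Require Import all_boot all_order all_algebra.
From mathcomp Require Import all_classical all_reals all_analysis.
From mathcomp Require Import measurable_realfun.
From mathcomp Require Import ring lra zify.

(* Release noisy sums along a Fenwick tree: node t carries the sum of the
   records indexed by (low t, t] plus independent Gaussian noise, and a prefix
   sum adds up the at most L nodes of a chain, where T < 2 ^ L.
   Privacy: for fixed coins of the adversary, adding to the noise an adapted
   shift, the difference of the node sums on the two sides, makes one side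
   produce the transcript of the other. By a discrete Girsanov formula the
   density of this shift is an exponential martingale, whose moment of order xi
   is at most exp(xi (xi - 1) B / (2 s^2)) when the squared length of the shift
   is at most B. A single record lies in at most L nodes, so B = D L. The view
   is a function of the shifted noise, and passing to it does not increase the
   moment.
   Accuracy: the noise of a prefix sum has at most L terms, so a Chernoff bound
   and a union bound over the T D prefix sums apply, whatever the adversary
   does. *)

Set Implicit Arguments.
Unset Strict Implicit.
Unset Printing Implicit Defensive.

Import Order.TTheory GRing.Theory Num.Theory.
Import numFieldNormedType.Exports.

Local Open Scope ring_scope.
Local Open Scope classical_set_scope.

(** * Shifting Gaussian noise *)

(** Lebesgue measure and its image under the translation agree on half-open intervals, hence
    everywhere by uniqueness. *)
Lemma ge0_integral_translation (R : realType) (c : R) (f : R -> \bar R) :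
  measurable_fun [set: R] f -> (forall x, (0 <= f x)%E) ->
  (\int[lebesgue_measure]_x f ((x : R) + c)%R =
   \int[lebesgue_measure]_x f x)%E.
Proof.
move=> mf f0.
have mc : measurable_fun [set: measurableTypeR R] (fun x : R => x + c : measurableTypeR R).
  exact: (@measurable_funD _ R R setT id (cst c)).
pose X (x : measurableTypeR R) : measurableTypeR R := (x : R) + c.
pose push := pushforward (@lebesgue_measure R) X : {measure set _ -> \bar R}.
pose mu := push mc.
have E A : measurable A -> lebesgue_measure A = mu A.
  apply: lebesgue_measure_unique => _ [[a b] _ <-].
  rewrite /mu /push /= /pushforward /=.
  have -> : X @^-1` `]a, b] = `](a - c), (b - c)]%classic.
    by apply/seteqP; split => x /=; rewrite !in_itv /= ltrBlDr lerBrDr.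
  rewrite !lebesgue_measure_itv /= !lte_fin ltrD2r.
  by rewrite -!EFinB opprB addrA subrK.
rewrite [RHS](@eq_measure_integral _ _ _ _ mu); last first.
  by move=> A mA _; exact: E.
by rewrite ge0_integral_pushforward.
Qed.

(** The Radon-Nikodym derivative of the normal law and [normal_pdf] have the same integral over
    every measurable set, so they agree almost everywhere. *)
Lemma ge0_integral_normal_prob (R : realType) (s : R) (f : R -> \bar R) :
  measurable_fun [set: R] f -> (forall x, (0 <= f x)%E) ->
  (\int[normal_prob 0 s]_x f x =
   \int[lebesgue_measure]_x (f x * (normal_pdf 0 s x)%:E))%E.
Proof.
move=> mf f0.
have dom := @normal_prob_dominates R 0 s.
have mpdf : measurable_fun [set: R] (fun x => (normal_pdf 0 s x)%:E).
  by apply/measurable_EFinP; exact: measurable_normal_pdf.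
rewrite -(@Radon_Nikodym_SigmaFinite.change_of_variables _ _ _
   (normal_prob 0 s) lebesgue_measure dom)//.
have mg := measurable_int _ (Radon_Nikodym_SigmaFinite.f_integrable dom).
apply: ae_eq_integral => //; try exact: emeasurable_funM.
apply: ae_eqe_mul2l.
apply: integral_ae_eq => //; first exact: Radon_Nikodym_SigmaFinite.f_integrable.
by move=> A _ mA; rewrite -Radon_Nikodym_SigmaFinite.f_integral.
Qed.

(* The library puts the normal law on [measurableTypeR R]; this is its copy on
   [R]. *)
Definition of_measurableTypeR (R : realType) (x : measurableTypeR R) : R := x.

Lemma measurable_of_measurableTypeR (R : realType) :
  measurable_fun setT (@of_measurableTypeR R).
Proof. by move=> _ B mB; rewrite setTI. Qed.

HB.instance Definition _ (R : realType) :=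
  isMeasurableFun.Build _ _ _ _ (@of_measurableTypeR R)
    (@measurable_of_measurableTypeR R).

Definition gauss (R : realType) (s : R) : probability R R :=
  distribution (normal_prob 0 s) (@of_measurableTypeR R).

(** Substitute [x + c] for [x]: as (x + c)^2 - x^2 = 2xc + c^2, the exponential is the ratio of the
    density at [x + c] to that at [x]. *)
Lemma gauss_shift (R : realType) (s c : R) (f : R -> \bar R) : s != 0 ->
  measurable_fun [set: R] f -> (forall x, (0 <= f x)%E) ->
  (\int[gauss s]_x f x = \int[gauss s]_x
   (f (x + c)%R * (expR (- ((2 * x * c + c ^+ 2) / (2 * s ^+ 2))))%:E))%E.
Proof.
move=> s0 mf f0.
have mfc : measurable_fun [set: R] (fun x => f (x + c)).
  by apply: measurableT_comp => //; exact: measurable_funD.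
have mpdf : measurable_fun [set: R] (normal_pdf 0 s) := @measurable_normal_pdf R 0 s.
have me : measurable_fun [set: R]
  (fun x => expR (- ((2 * x * c + c ^+ 2) / (2 * s ^+ 2)))).
  apply: measurableT_comp => //; apply: measurableT_comp => //.
  apply: measurable_funM => //; apply: measurable_funD => //.
  by apply: measurable_funM => //; apply: measurable_funM.
have h0 x : (0 <= f (x + c)%R *
    (expR (- ((2 * x * c + c ^+ 2) / (2 * s ^+ 2))))%:E)%E.
  by rewrite mule_ge0 ?lee_fin ?expR_ge0.
have mh : measurable_fun [set: R] (fun x => f (x + c)%R *
    (expR (- ((2 * x * c + c ^+ 2) / (2 * s ^+ 2))))%:E)%E.
  by apply: emeasurable_funM => //; exact/measurable_EFinP.
rewrite !ge0_integral_distribution// !ge0_integral_normal_prob//.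
rewrite -(ge0_integral_translation c); first last.
- by move=> x; rewrite mule_ge0 ?lee_fin ?normal_pdf_ge0.
- by apply: emeasurable_funM => //; exact/measurable_EFinP.
apply: eq_integral => x _ /=; rewrite -muleA -EFinM; congr (_ * _%:E)%E.
rewrite !normal_pdfE// /normal_fun !subr0 mulrCA -expRD; congr (_ * expR _).
rewrite /of_measurableTypeR -mulr_natl; field; exact: s0.
Qed.

Definition tuple_cons (R : realType) n (p : R * n.-tuple R) : n.+1.-tuple R :=
  [tuple of p.1 :: p.2].

Lemma measurable_tuple_cons (R : realType) n :
  measurable_fun [set: R * n.-tuple R] (@tuple_cons R n).
Proof. exact: measurable_cons. Qed.

HB.instance Definition _ (R : realType) n :=
  isMeasurableFun.Build _ _ _ _ (@tuple_cons R n) (@measurable_tuple_cons R n).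

(** Entry 0 is split off first because it is the first one that an adapted shift reads; the
    induction in [girsanov] follows this order. *)
Fixpoint gauss_vec (R : realType) (s : R) n : probability (n.-tuple R) R :=
  if n is n'.+1 then
    distribution (gauss s \x gauss_vec s n')%E (@tuple_cons R n')
  else \d_ [tuple].

(** The likelihood ratio of the centred Gaussian vector between the points [z + delta z] and [z]. *)
Definition gauss_density (R : realType) (s : R) n
    (delta : nat -> n.-tuple R -> R) (z : n.-tuple R) : R :=
  expR (- ((\sum_(i < n) (2 * tnth z i * delta i z + delta i z ^+ 2)) /
           (2 * s ^+ 2))).

Definition shift_vec (R : realType) n
    (delta : nat -> n.-tuple R -> R) (z : n.-tuple R) : n.-tuple R :=
  [tuple tnth z i + delta i z | i < n].

(* delta k may depend on the entries 0, ..., k - 1 only. *)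
Definition adapted (S : Type) U n (delta : nat -> n.-tuple S -> U) : Prop :=
  forall k (z z' : n.-tuple S), take k z = take k z' -> delta k z = delta k z'.

Lemma measurable_shift_vec (R : realType) n (delta : nat -> n.-tuple R -> R) :
  (forall k, measurable_fun setT (delta k)) ->
  measurable_fun setT (shift_vec delta).
Proof.
move=> md; apply/measurable_fun_tnthP => i.
rewrite (_ : _ \o _ = fun z => tnth z i + delta i z).
  by apply: measurable_funD => //; exact: measurable_tnth.
by apply/funext => z /=; rewrite tnth_mktuple.
Qed.

Lemma measurable_gauss_density (R : realType) (s : R) n
  (delta : nat -> n.-tuple R -> R) :
  (forall k, measurable_fun setT (delta k)) ->
  measurable_fun setT (gauss_density s delta).
Proof.
move=> md; apply: measurableT_comp => //; apply: measurableT_comp => //.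
apply: measurable_funM => //; apply: measurable_sum => i.
apply: measurable_funD; last exact: measurable_funX.
by apply: measurable_funM => //; apply: measurable_funM => //; exact: measurable_tnth.
Qed.

Lemma measurable_girsanov (R : realType) (s : R) n
    (delta : nat -> n.-tuple R -> R) (f : n.-tuple R -> \bar R) :
  (forall k, measurable_fun setT (delta k)) -> measurable_fun setT f ->
  measurable_fun setT
    (fun z => f (shift_vec delta z) * (gauss_density s delta z)%:E)%E.
Proof.
move=> md mf; apply: emeasurable_funM.
  by apply: measurableT_comp => //; exact: measurable_shift_vec.
by apply/measurable_EFinP; exact: measurable_gauss_density.
Qed.

(** Induction on [n]. The shift of entry 0 is a constant, treated by [gauss_shift]; once entry 0 is
    fixed, the shift of the remaining entries is again adapted, and the two exponential factors
    multiply. *)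
Lemma girsanov (R : realType) (s : R) n (delta : nat -> n.-tuple R -> R)
    (f : n.-tuple R -> \bar R) : s != 0 ->
  (forall k, measurable_fun setT (delta k)) -> adapted delta ->
  measurable_fun setT f -> (forall z, (0 <= f z)%E) ->
  (\int[gauss_vec s n]_z f z = \int[gauss_vec s n]_z
     (f (shift_vec delta z) * (gauss_density s delta z)%:E))%E.
Proof.
move=> s0; elim: n delta f => [|n IH] delta f md ad mf f0.
  rewrite /= !integral_dirac//; last exact: measurable_girsanov.
  rewrite /gauss_density big_ord0 mul0r oppr0 expR0 mule1.
  by rewrite !diracT !mul1e (tuple0 (shift_vec delta _)).
have mg := measurable_girsanov s md mf.
have g0 z : (0 <= f (shift_vec delta z) * (gauss_density s delta z)%:E)%E.
  by rewrite mule_ge0 ?lee_fin ?expR_ge0.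
have mpair (x : R) : measurable_fun [set: n.-tuple R] (fun z => tuple_cons (x, z)).
  by apply: measurableT_comp => //; exact: measurable_tuple_cons.
have mtc := @measurable_tuple_cons R n.
rewrite /= !ge0_integral_distribution//.
rewrite !fubini_tonelli1//=; try exact: measurableT_comp.
rewrite /fubini_F/=.
(* The zero tuple is an arbitrary argument: by adaptedness [delta 0] reads no entry. *)
pose c := delta 0%N [tuple of nseq n.+1 0].
have d0 z : delta 0%N z = c by apply: ad; rewrite !take0.
rewrite (gauss_shift c s0)//; last 2 first.
- apply: (measurable_fun_fubini_tonelli_F (f \o @tuple_cons R n)).
    exact: measurableT_comp.
  by move=> x; exact: f0.
- by move=> x; apply: integral_ge0 => z _ /=; exact: f0.
rewrite -/(gauss s); apply: eq_integral => x _.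
(* After the substitution [x] is the unshifted entry 0, which is the value that [delta] reads. *)
pose dl k (z : n.-tuple R) := delta k.+1 (tuple_cons (x, z)).
rewrite (IH dl); first last.
- by move=> z; exact: f0.
- by apply: measurableT_comp.
- by move=> k z z' zz; apply: ad; rewrite /= zz.
- by move=> k; apply: measurableT_comp.
rewrite -ge0_integralZr//; first last.
- by move=> z _; rewrite mule_ge0 ?lee_fin ?expR_ge0.
- apply: (measurable_girsanov s (delta := dl)
    (f := fun z => f (tuple_cons (x + c, z)))) => [k|]; exact: measurableT_comp.
apply: eq_integral => z _; rewrite -muleA -EFinM; congr (f _ * _%:E)%E.
  apply: eq_from_tnth => i; rewrite tnth_mktuple.
  have [j ->|->] := unliftP ord0 i; last by rewrite d0.
  by rewrite /tuple_cons /= !tnthS tnth_mktuple.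
rewrite -expRD; congr expR; rewrite -opprD -mulrDl big_ord_recl d0 addrC.
by congr (- ((_ + _) / _)); apply: eq_bigr => i _; rewrite tnthS.
Qed.

(** * Renyi divergence of two image measures *)

(** Young's inequality for the conjugate exponents xi / (xi - 1) and xi. *)
Lemma young_powR (R : realType) (xi a b : R) : 1 < xi -> 0 <= a -> 0 <= b ->
  a `^ (xi - 1) * b <= (1 - xi^-1) * a `^ xi + xi^-1 * b `^ xi.
Proof.
move=> xi1 a0 b0.
have xi0 : 0 < xi by lra.
have xm : 0 < xi - 1 by lra.
have q0 : 0 < xi / (xi - 1) by rewrite divr_gt0.
have qV : (xi / (xi - 1))^-1 = 1 - xi^-1 by field; rewrite ?gt_eqF.
have qE : (xi - 1) * (xi / (xi - 1)) = xi by field; rewrite ?gt_eqF.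
have := conjugate_powR (powR_ge0 a (xi - 1)) b0 q0 xi0.
by rewrite -powRrM qE qV subrK => /(_ erefl); rewrite ![_ `^ xi * _]mulrC.
Qed.

(* With X the left-hand side, Young's inequality yields
   X <= (1 - 1/xi) X + C/xi; truncating g makes X finite, so that it can be
   cancelled. *)
Lemma truncated_moment_le d (V : measurableType d) d' (W : measurableType d')
    (R : realType) (P : probability W R) (Q' : probability V R)
    (F : W -> V) (p : W -> R) (g : V -> R) (xi C : R) (n : nat) :
  1 < xi -> measurable_fun setT F -> measurable_fun setT p ->
  measurable_fun setT g ->
  (forall w, 0 <= p w) -> (forall v, 0 <= g v) ->
  (forall f : V -> \bar R, measurable_fun setT f -> (forall v, 0 <= f v)%E ->
     \int[Q']_v f v = \int[P]_w f (F w))%E ->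
  (forall f : V -> \bar R, measurable_fun setT f -> (forall v, 0 <= f v)%E ->
     \int[Q']_v (f v * (g v)%:E) = \int[P]_w (f (F w) * (p w)%:E))%E ->
  (\int[P]_w (p w `^ xi)%:E <= C%:E)%E ->
  (\int[Q']_v (Num.min (g v) n%:R `^ xi)%:E <= C%:E)%E.
Proof.
move=> xi1 mF mp mg p0 g0 QP QgP pC.
have xi0 : 0 < xi by lra.
have xi_ge1 : 0 <= xi - 1 by lra.
pose gn v := Num.min (g v) n%:R.
have gn0 v : 0 <= gn v by rewrite le_min g0/=.
have mgn : measurable_fun setT gn by apply: measurable_minr.
have mpow r (h : V -> R) : measurable_fun setT h ->
    measurable_fun setT (fun v => h v `^ r).
  by move=> mh; apply: (measurableT_comp (measurable_powR r)).
have mpowW r (h : W -> R) : measurable_fun setT h ->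
    measurable_fun setT (fun v => h v `^ r).
  by move=> mh; apply: (measurableT_comp (measurable_powR r)).
pose X := (\int[Q']_v (gn v `^ xi)%:E)%E.
have X0 : (0 <= X)%E by apply: integral_ge0 => v _; rewrite lee_fin powR_ge0.
have Xfin : X \is a fin_num.
  rewrite ge0_fin_numE//; apply: (@le_lt_trans _ _ (\int[Q']_v (n%:R `^ xi)%:E)%E).
    apply: ge0_le_integral => //.
    - by move=> v _; rewrite lee_fin powR_ge0.
    - by apply/measurable_EFinP; exact: mpow.
    - move=> v _; rewrite lee_fin; apply: ge0_ler_powR; rewrite ?nnegrE//; first exact: ltW.
      by rewrite ge_min lexx orbT.
  by rewrite integral_cst//= probability_setT mule1 ltry.
have XW : X = (\int[P]_w (gn (F w) `^ xi)%:E)%E.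
  rewrite /X (QP (fun v => (gn v `^ xi)%:E))//.
    by apply/measurable_EFinP; exact: mpow.
  by move=> v; rewrite lee_fin powR_ge0.
suff : (X <= (1 - xi^-1)%:E * X + xi^-1%:E * C%:E)%E.
  move=> H; change (X <= C%:E)%E; move: H; rewrite -(fineK Xfin) -!EFinM -EFinD !lee_fin => H.
  have : xi^-1 * fine X <= xi^-1 * C by lra.
  by rewrite ler_pM2l// invr_gt0.
have mgnF : measurable_fun setT (fun w => gn (F w)) by exact: measurableT_comp.
(* One of the xi factors [gn] is raised to [g], so that the integral against the density [g] can be
   rewritten as one over [P] with weight [p]. *)
apply: (@le_trans _ _ (\int[Q']_v ((gn v `^ (xi - 1))%:E * (g v)%:E))%E).
  apply: ge0_le_integral => //.
  - by move=> v _; rewrite lee_fin powR_ge0.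
  - by apply/measurable_EFinP; exact: mpow.
  - by apply/measurable_EFinP; apply: measurable_funM => //; exact: mpow.
  - move=> v _; rewrite -EFinM lee_fin -mulr_powRB1// mulrC ler_wpM2l ?powR_ge0//.
    by rewrite ge_min lexx.
rewrite (QgP (fun v => (gn v `^ (xi - 1))%:E)); first last.
- by move=> v; rewrite lee_fin powR_ge0.
- by apply/measurable_EFinP; exact: mpow.
apply: (@le_trans _ _ (\int[P]_w ((1 - xi^-1)%:E * (gn (F w) `^ xi)%:E +
    xi^-1%:E * (p w `^ xi)%:E))%E).
  apply: ge0_le_integral => //.
  - by move=> w _; rewrite -EFinM lee_fin mulr_ge0 ?powR_ge0.
  - by apply/measurable_EFinP; apply: measurable_funM => //; exact: mpowW.
  - apply/measurable_EFinP; apply: measurable_funD; apply: measurable_funM => //; exact: mpowW.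
  - by move=> w _; rewrite -!EFinM -EFinD lee_fin young_powR.
have c0 : 0 <= 1 - xi^-1 by rewrite subr_ge0 invf_le1// ltW.
have mgx : measurable_fun setT (fun w => (gn (F w) `^ xi)%:E).
  by apply/measurable_EFinP; exact: mpowW.
have mpx : measurable_fun setT (fun w => (p w `^ xi)%:E).
  by apply/measurable_EFinP; exact: mpowW.
rewrite ge0_integralD//; first last.
- by apply: emeasurable_funM.
- by move=> w _; rewrite -EFinM lee_fin mulr_ge0 ?powR_ge0// invr_ge0 ltW.
- by apply: emeasurable_funM.
- by move=> w _; rewrite -EFinM lee_fin mulr_ge0 ?powR_ge0.
have c1 : 0 <= xi^-1 by rewrite invr_ge0 ltW.
rewrite !ge0_integralZl//; try by move=> w _; rewrite lee_fin powR_ge0.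
rewrite XW leeD2l// lee_wpmul2l// lee_fin invr_ge0 ltW//.
Qed.

(** Monotone convergence: at each point the truncations increase and eventually equal [g]. *)
Lemma moment_le_truncated d (V : measurableType d) (R : realType)
    (Q' : probability V R) (g : V -> R) (xi C : R) : 0 < xi ->
  measurable_fun setT g -> (forall v, 0 <= g v) ->
  (forall n, \int[Q']_v (Num.min (g v) n%:R `^ xi)%:E <= C%:E)%E ->
  (\int[Q']_v (g v `^ xi)%:E <= C%:E)%E.
Proof.
move=> xi0 mg g0 gC.
pose h n v := (Num.min (g v) n%:R `^ xi)%:E.
have mh n : measurable_fun setT (h n).
  apply/measurable_EFinP; apply: (measurableT_comp (measurable_powR xi)).
  exact: measurable_minr.
have h0 n v : setT v -> (0 <= h n v)%E by rewrite lee_fin powR_ge0.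
have ndh v : setT v -> nondecreasing_seq (h ^~ v).
  move=> _ a b ab; rewrite lee_fin; apply: ge0_ler_powR.
  - exact: ltW.
  - by rewrite nnegrE le_min g0/=.
  - by rewrite nnegrE le_min g0/=.
  - by rewrite le_min !ge_min lexx/= ler_nat ab orbT.
have limh v : limn (h ^~ v) = (g v `^ xi)%:E.
  apply: cvg_lim => //; apply: (@cvg_near_cst _ _ _ _ _ eventually_filter).
  near=> n; rewrite /h min_l//.
  near: n; exact: nbhs_infty_ger.
under eq_integral do rewrite -limh.
have cvg_h : (\int[Q']_x h n x)%E @[n --> \oo] --> (\int[Q']_x limn (h^~ x))%E.
  exact: cvg_monotone_convergence.
by rewrite -(cvg_lim _ cvg_h)//; apply: lime_le; [exact: cvgP cvg_h|exact: nearW].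
Unshelve. all: end_near. Qed.

(** A form of the data-processing inequality: [F'] under the weight [p] has the law of [F], and the
    derivative of the image laws has a moment no larger than that of [p]. *)
Lemma renyi_divergence_distribution_le d (V : measurableType d)
    d' (W : measurableType d') (R : realType) (P : probability W R)
    (F F' : {mfun W >-> V}) (p : W -> R) (xi rho : R) :
  1 < xi -> measurable_fun setT p -> (forall w, 0 <= p w) ->
  (forall f : V -> \bar R, measurable_fun setT f -> (forall v, 0 <= f v)%E ->
     \int[P]_w f (F w) = \int[P]_w (f (F' w) * (p w)%:E))%E ->
  (\int[P]_w (p w `^ xi)%:E <= (expR (xi * (xi - 1) * rho))%:E)%E ->
  (renyi_divergence xi (distribution P F) (distribution P F') <= (xi * rho)%:E)%E.
Proof.
move=> xi1 mp p0 FF' pC.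
set Q := distribution P F; set Q' := distribution P F'.
have QQ' : Q `<< Q'.
  (* [Q A] is the integral of [p] over the preimage of [A] under [F'], a null set when [Q' A]
     vanishes. *)
  apply/null_content_dominatesP => A mA.
  have mI : measurable_fun setT (fun v : V => (\1_A v : R)%:E).
    by apply/measurable_EFinP; exact: measurable_indic.
  have -> : Q A = (\int[P]_w (\1_A (F w) : R)%:E)%E.
    transitivity (\int[Q]_v (\1_A v : R)%:E)%E.
      by rewrite integral_indic// setIT.
    by rewrite ge0_integral_distribution.
  move=> Q'A0; rewrite (FF' (fun v => (\1_A v)%:E))//.
  have mA' : measurable (F' @^-1` A) by rewrite -[_ @^-1` _]setTI; exact: measurable_funP.
  rewrite -[RHS](@null_set_integral _ _ _ P (F' @^-1` A) (EFin \o p))//.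
    rewrite integral_mkcond; apply: eq_integral => w _.
    rewrite patchE indicE (_ : (w \in _) = (F' w \in A)).
      by case: ifP; rewrite ?mul1e ?mul0e.
    by apply/idP/idP; rewrite !inE.
  exact/measurable_funTS/measurable_EFinP.
rewrite /renyi_divergence; case: pselect => // dom.
(* This version of the derivative is finite and nonnegative at every point; it equals
   [Radon_Nikodym] almost everywhere, which suffices under the integral. *)
pose g v := fine (Radon_Nikodym_SigmaFinite.f Q Q' v).
have gE v : (g v)%:E = Radon_Nikodym_SigmaFinite.f Q Q' v.
  by rewrite fineK//; exact: Radon_Nikodym_SigmaFinite.f_fin_num.
have g0 v : 0 <= g v.
  by apply: fine_ge0; exact: Radon_Nikodym_SigmaFinite.f_ge0.
have mRN := measurable_int _ (Radon_Nikodym_SigmaFinite.f_integrable dom).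
have mg : measurable_fun setT g by apply: measurableT_comp.
have -> : (\int[Q']_r
    poweR (Radon_Nikodym (charge_of_finite_measure Q) Q' r) xi =
    \int[Q']_r (g r `^ xi)%:E)%E.
  apply: ae_eq_integral => //.
  - have RNE v := fineK (@Radon_Nikodym_fin_num _ _ _
      (charge_of_finite_measure Q) Q' v dom).
    under eq_fun do rewrite -RNE.
    apply/measurable_EFinP; apply: (measurableT_comp (measurable_powR xi)).
    apply: measurableT_comp => //.
  - by apply/measurable_EFinP; apply: (measurableT_comp (measurable_powR xi)).
  - have := @ae_eq_Radon_Nikodym_SigmaFinite _ _ _ Q Q' dom setT measurableT.
    apply: filterS => v /= H _; rewrite -H//= -gE//.
have main : (\int[Q']_r (g r `^ xi)%:E <= (expR (xi * (xi - 1) * rho))%:E)%E.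
  apply: moment_le_truncated => //; first by lra.
  move=> n; apply: (@truncated_moment_le _ _ _ _ _ P Q' F' p) => //.
  - by move=> f mf f0; rewrite ge0_integral_distribution.
  - move=> f mf f0; rewrite -FF'//.
    under eq_integral do rewrite gE.
    rewrite Radon_Nikodym_SigmaFinite.change_of_variables//.
    by rewrite ge0_integral_distribution.
rewrite lee_pdivrMl ?subr_gt0//.
apply: (@le_trans _ _ (lne (expR (xi * (xi - 1) * rho))%:E)).
  rewrite lee_lne// in_itv /= ?andbT ?lee_fin ?expR_ge0 ?leey//.
    by rewrite andbT; apply: integral_ge0 => v _; rewrite lee_fin powR_ge0.
rewrite lne_EFin ?expR_gt0// expRK lee_fin; lra.
Qed.

(** * Moments of the shift density and the divergence of an adaptive shift *)

(** Girsanov's formula for the constant function 1. *)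
Lemma integral_gauss_density (R : realType) (s : R) n
    (delta : nat -> n.-tuple R -> R) : s != 0 ->
  (forall k, measurable_fun setT (delta k)) -> adapted delta ->
  (\int[gauss_vec s n]_z (gauss_density s delta z)%:E = 1)%E.
Proof.
move=> s0 md ad; have := girsanov s0 md ad (f := cst 1%E).
rewrite integral_cst//= probability_setT mule1 => ->//.
by apply: eq_integral => z _; rewrite mul1e.
Qed.

(** With Z the linear and D the quadratic sum, xi (Z + D) = (xi Z + xi^2 D) - xi (xi - 1) D. The
    first part is the exponent for the shift [xi * delta], whose density integrates to 1; the second
    is controlled by [B]. *)
Lemma gauss_density_powR (R : realType) (s xi B : R) n
    (delta : nat -> n.-tuple R -> R) (z : n.-tuple R) : s != 0 -> 1 < xi ->
  \sum_(i < n) delta i z ^+ 2 <= B ->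
  gauss_density s delta z `^ xi <=
  gauss_density s (fun k z => xi * delta k z) z *
  expR (xi * (xi - 1) * (B / (2 * s ^+ 2))).
Proof.
move=> s0 xi1 dB.
rewrite -expRM -expRD ler_expR.
under [X in _ <= - (X / _) + _]eq_bigr do rewrite exprMn mulrCA.
rewrite !big_split/= -!mulr_sumr.
set Z := \sum_(i < n) 2 * _ * _; set D := \sum_(i < n) _ ^+ 2 in dB *.
rewrite [leLHS](_ : _ = - ((xi * Z + xi ^+ 2 * D) / (2 * s ^+ 2)) +
    xi * (xi - 1) * (D / (2 * s ^+ 2))); last by ring.
rewrite lerD2l ler_wpM2l//; first by apply: mulr_ge0; lra.
by rewrite ler_wpM2r// invr_ge0 mulr_ge0// sqr_ge0.
Qed.

(** By Fubini the coins [w] are fixed first. Girsanov's formula then replaces [F] by its value at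
    the shifted noise, which is [F'], at the price of the weight [gauss_density]. *)
Lemma renyi_divergence_adaptive_shift (R : realType) (s xi B : R) n
    dW (W : measurableType dW) (Q : probability W R)
    dV (V : measurableType dV) (F F' : {mfun (n.-tuple R * W)%type >-> V})
    (delta : W -> nat -> n.-tuple R -> R) : s != 0 -> 1 < xi ->
  (forall k, measurable_fun setT (fun zw : n.-tuple R * W => delta zw.2 k zw.1)) ->
  (forall w, adapted (delta w)) ->
  (forall w z, \sum_(i < n) delta w i z ^+ 2 <= B) ->
  (forall w z, F (shift_vec (delta w) z, w) = F' (z, w)) ->
  (renyi_divergence xi (distribution (gauss_vec s n \x Q)%E F)
     (distribution (gauss_vec s n \x Q)%E F') <=
   (xi * (B / (2 * s ^+ 2)))%:E)%E.
Proof.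
move=> s0 xi1 md ad dB FF'.
have mdw w k : measurable_fun setT (delta w k).
  exact: (measurableT_comp (md k) (measurable_pair2 w)).
have mdens c : measurable_fun setT (fun zw : n.-tuple R * W =>
    gauss_density s (fun k z => c * delta zw.2 k z) zw.1).
  apply: measurableT_comp => //; apply: measurableT_comp => //.
  apply: measurable_funM => //; apply: measurable_sum => i.
  have mi : measurable_fun setT (fun zw : n.-tuple R * W => tnth zw.1 i).
    by apply: (measurableT_comp (measurable_tnth i)).
  apply: measurable_funD; last by apply: measurable_funX; apply: measurable_funM.
  by apply: measurable_funM; apply: measurable_funM.
have mp : measurable_fun setT (fun zw : n.-tuple R * W =>
    gauss_density s (delta zw.2) zw.1).
  apply: eq_measurable_fun (mdens 1) => zw _.
  by rewrite /gauss_density; under eq_bigr do rewrite mul1r.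
apply: (renyi_divergence_distribution_le xi1 mp) => [w|f mf f0|].
- exact: expR_ge0.
- pose h zw : \bar R := (f (F' zw) * (gauss_density s (delta zw.2) zw.1)%:E)%E.
  have mfF : measurable_fun setT (f \o F) by exact: measurableT_comp.
  have mh : measurable_fun setT h.
    by apply: emeasurable_funM; [exact: measurableT_comp|exact/measurable_EFinP].
  have h0 zw : (0 <= h zw)%E by rewrite mule_ge0// lee_fin expR_ge0.
  rewrite (fubini_tonelli2 (f \o F))//; last by move=> zw; exact: f0.
  rewrite (fubini_tonelli2 h mh h0).
  apply: eq_integral => w _; rewrite /fubini_G.
  rewrite (girsanov s0 (mdw w) (ad w)); last 2 first.
  + by apply: measurableT_comp => //; exact: measurableT_comp.
  + by move=> z; exact: f0.
  by apply: eq_integral => z _; rewrite /h /= FF'.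
- apply: (@le_trans _ _ (\int[gauss_vec s n \x Q]_zw
    ((gauss_density s (fun k z => xi * delta zw.2 k z) zw.1)%:E *
     (expR (xi * (xi - 1) * (B / (2 * s ^+ 2))))%:E))%E).
    apply: ge0_le_integral => //.
    + by move=> w _; rewrite lee_fin powR_ge0.
    + by apply/measurable_EFinP; apply: (measurableT_comp (measurable_powR xi)).
    + by apply: emeasurable_funM => //; exact/measurable_EFinP.
    + by move=> w _; rewrite -EFinM lee_fin; exact: gauss_density_powR.
  rewrite ge0_integralZr//=; first last.
  + by move=> w _; rewrite lee_fin expR_ge0.
  + exact/measurable_EFinP.
  rewrite (fubini_tonelli2 (fun zw : n.-tuple R * W =>
    (gauss_density s (fun k z => xi * delta zw.2 k z) zw.1)%:E))//; first last.
  + by move=> w; rewrite lee_fin expR_ge0.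
  + exact/measurable_EFinP.
  rewrite (eq_integral (cst 1%E)); last first.
    move=> w _; rewrite /fubini_G/= integral_gauss_density//.
      by move=> k; apply: measurable_funM.
    by move=> k z z' zz; rewrite (ad w k z z').
  by rewrite integral_cst//= probability_setT mule1 mul1e.
Qed.

(** * Tails of sums of noise entries *)

Lemma sum_ord_mem (R : realType) n (l : seq nat) (F : nat -> R) :
  uniq l -> all (ltn^~ n) l ->
  \sum_(i < n) (F i * (val i \in l)%:R) = \sum_(k <- l) F k.
Proof.
move=> ul ln; under eq_bigr do rewrite mulr_natr mulrb.
rewrite -big_mkcond /= -(big_mkord (fun i => i \in l) F) -big_filter.
apply: perm_big; apply: uniq_perm => //.
  by rewrite filter_uniq// /index_iota iota_uniq.
move=> k; rewrite mem_filter mem_index_iota /=.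
by case: (boolP (k \in l)) => //= kl; have /= := allP ln _ kl.
Qed.

Lemma measurable_nth_tuple (R : realType) n k :
  measurable_fun setT (fun z : n.-tuple R => nth 0 z k).
Proof.
have [kn|nk] := ltnP k n.
  rewrite (_ : (fun _ => _) = (fun z => tnth z (Ordinal kn))).
    exact: measurable_tnth.
  by apply/funext => z; rewrite (tnth_nth 0).
rewrite (_ : (fun _ => _) = cst 0)//.
by apply/funext => z; rewrite nth_default// size_tuple.
Qed.

(** Up to a constant factor the integrand is the density of the constant shift by -c s^2 of the
    entries listed in [l], and that density has integral 1. *)
Lemma gauss_vec_mgf (R : realType) (s c : R) n (l : seq nat) :
  s != 0 -> uniq l -> all (ltn^~ n) l ->
  (\int[gauss_vec s n]_z (expR (c * \sum_(k <- l) nth 0 z k))%:E =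
   (expR (c ^+ 2 * s ^+ 2 * (size l)%:R / 2))%:E)%E.
Proof.
move=> s0 ul ln.
pose d (k : nat) (z : n.-tuple R) : R := - (c * s ^+ 2) * (k \in l)%:R.
have dE (z : n.-tuple R) : expR (c * \sum_(k <- l) nth 0 z k) =
    gauss_density s d z * expR (c ^+ 2 * s ^+ 2 * (size l)%:R / 2).
  have -> : gauss_density s d z = expR (- ((\sum_(k <- l)
      (2 * nth 0 z k * - (c * s ^+ 2) + (c * s ^+ 2) ^+ 2)) / (2 * s ^+ 2))).
    rewrite /gauss_density -(sum_ord_mem (fun k =>
      2 * nth 0 z k * - (c * s ^+ 2) + (c * s ^+ 2) ^+ 2) ul ln).
    congr expR; congr (- _); congr (_ / _); apply: eq_bigr => i _.
    by rewrite /d (tnth_nth 0); case: (_ \in l) => /=; ring.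
  rewrite -expRD; congr expR.
  rewrite big_split/= -mulr_suml -mulr_sumr big_const_seq count_predT iter_addr_0.
  rewrite -mulr_natr; field; exact: s0.
under eq_integral do rewrite dE EFinM.
have md k : measurable_fun setT (d k) by exact: measurable_cst.
rewrite ge0_integralZr//=.
- by rewrite integral_gauss_density ?mul1e.
- by apply/measurable_EFinP; exact: measurable_gauss_density.
- by move=> z _; rewrite lee_fin expR_ge0.
Qed.

Lemma gauss_vec_tail (R : realType) (s a : R) n m (l : seq nat) :
  0 < s -> uniq l -> all (ltn^~ n) l -> (size l <= m)%N -> (0 < m)%N -> 0 <= a ->
  (gauss_vec s n [set z : n.-tuple R | (`|\sum_(k <- l) nth 0 z k| > a)%R]%classic <=
   (2 * expR (- (a ^+ 2 / (2 * m%:R * s ^+ 2))))%:E)%E.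
Proof.
move=> s0 ul ln lm m0 a0.
pose S (z : n.-tuple R) : R := \sum_(k <- l) nth 0 z k.
have mS : measurable_fun setT S.
  by apply: measurable_sum => k; exact: measurable_nth_tuple.
(* The minimizer of the Chernoff exponent c^2 s^2 m / 2 - c a, with minimum -a^2 / (2 m s^2). *)
pose c : R := a / (m%:R * s ^+ 2).
have mR : 0 < m%:R :> R by rewrite ltr0n.
have c0 : 0 <= c by rewrite divr_ge0// mulr_ge0// ?sqr_ge0.
set A := [set z | _]%classic.
have mA : measurable A.
  rewrite [A](_ : _ = (fun z => `|S z|) @^-1` `]a, +oo[); last first.
    by apply/seteqP; split => z; rewrite /A /= in_itv /= andbT.
  rewrite -[X in measurable X]setTI; apply: measurableT_comp => //.
have mE r : measurable_fun setT (fun z => (expR (r * S z))%:E).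
  by apply/measurable_EFinP; apply: measurableT_comp => //; apply: measurable_funM.
rewrite -[A]setIT -integral_indic//.
apply: (@le_trans _ _ (\int[gauss_vec s n]_z
   (((expR (c * S z))%:E + (expR (- c * S z))%:E) * (expR (- (c * a)))%:E))%E).
  apply: ge0_le_integral => //.
  - exact/measurable_EFinP/measurable_indic.
  - by apply: emeasurable_funM => //; apply: emeasurable_funD.
  move=> z _; rewrite -EFinD -EFinM lee_fin indicE mulrDl -!expRD.
  have [|_] := boolP (z \in A); last by rewrite addr_ge0// expR_ge0.
  rewrite inE /A /= -/(S z) => /ltW aS.
  have [S0|S0] := lerP 0 (S z).
    rewrite ger0_norm// in aS; rewrite -[1%:R]addr0 lerD ?expR_ge0//.
    by rewrite -[leLHS]expR0 ler_expR subr_ge0 ler_wpM2l.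
  rewrite ltr0_norm// in aS; rewrite -[1%:R]add0r lerD ?expR_ge0//.
  by rewrite -[leLHS]expR0 ler_expR mulNr -mulrN subr_ge0 ler_wpM2l.
have E0 r z : (0 <= (expR (r * S z))%:E)%E by rewrite lee_fin expR_ge0.
rewrite ge0_integralZr//=; first last.
- by move=> z _; rewrite adde_ge0.
- exact: emeasurable_funD.
rewrite ge0_integralD//= !gauss_vec_mgf ?gt_eqF// sqrrN -EFinD -EFinM lee_fin.
rewrite -mulr2n -[X in X * _]mulr_natl -mulrA ler_pM2l// -expRD ler_expR.
have lR : (size l)%:R <= m%:R :> R by rewrite ler_nat.
have c2 : 0 <= c ^+ 2 * s ^+ 2 / 2 by rewrite divr_ge0// mulr_ge0// sqr_ge0.
apply: (@le_trans _ _ (c ^+ 2 * s ^+ 2 / 2 * m%:R - c * a)).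
  by rewrite lerD2r mulrAC ler_wpM2l.
by rewrite le_eqVlt; apply/orP; left; apply/eqP; rewrite /c; field; rewrite ?gt_eqF.
Qed.

(** * Fenwick trees *)

(* Node t >= 1 covers the indices r with low t < r <= t, where low t clears the
   lowest set bit of t; L bounds the number of bits. *)
Fixpoint fenwick_low (L t : nat) : nat :=
  if L is L'.+1 then
    if odd t then t.-1 else (fenwick_low L' t./2).*2
  else 0.

(** The nodes t, low t, low (low t), ..., stopped before 0; for t < 2 ^ L their intervals tile (0,
    t]. *)
Fixpoint fenwick_chain (L t : nat) : seq nat :=
  if L is L'.+1 then
    let s := map double (fenwick_chain L' t./2) in if odd t then t :: s else s
  else [::].

Lemma size_fenwick_chain L t : (size (fenwick_chain L t) <= L)%N.
Proof.
elim: L t => //= L IH t; case: ifP => _ /=; rewrite size_map.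
  by rewrite ltnS.
exact: leqW.
Qed.

Lemma mem_fenwick_chain L t s : s \in fenwick_chain L t -> (0 < s <= t)%N.
Proof.
elim: L t s => //= L IH t s.
have H : s \in [seq i.*2 | i <- fenwick_chain L t./2] -> (0 < s <= t)%N.
  by case/mapP => i /IH + ->; lia.
case: ifP => // ot; rewrite inE => /orP[/eqP ->|/H//].
by rewrite leqnn andbT; case: t ot {H}.
Qed.

Lemma uniq_fenwick_chain L t : uniq (fenwick_chain L t).
Proof.
elim: L t => //= L IH t.
have H : uniq [seq i.*2 | i <- fenwick_chain L t./2].
  by rewrite map_inj_uniq// => i j; lia.
case: ifP => //= ot; rewrite H andbT; apply/negP => /mapP[i _ ti].
by rewrite ti odd_double in ot.
Qed.

(** The intervals of the chain are adjacent, so the sum telescopes. The induction drops the lowest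
    bit: the even nodes are a chain for [G \o double], and an odd t adds G t - G (t - 1). *)
Lemma sum_fenwick_chain (V : zmodType) (G : nat -> V) L t : (t < 2 ^ L)%N ->
  \sum_(s <- fenwick_chain L t) (G s - G (fenwick_low L s)) = G t - G 0%N.
Proof.
elim: L t G => [|L IH] t G /=.
  by rewrite big_nil ltnS leqn0 => /eqP ->; rewrite subrr.
rewrite expnS => tL.
have E : \sum_(s <- [seq i.*2 | i <- fenwick_chain L t./2])
    (G s - G (fenwick_low L.+1 s)) = G (t./2).*2 - G 0%N.
  rewrite big_map; under eq_bigr do rewrite /= odd_double doubleK.
  by rewrite (IH _ (G \o double))//; lia.
case: ifP => ot; rewrite ?big_cons ?E//= ?ot.
  have -> : t./2.*2 = t.-1 by lia.
  by rewrite addrA subrK.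
by congr (G _ - _); lia.
Qed.

(** Each bit level has at most one node covering [r]: the odd node s covers s alone, and the even
    node 2k covers [r] exactly when node k covers the upper half of [r]. *)
Lemma fenwick_low_coverage L r :
  (\sum_(s < 2 ^ L) (fenwick_low L s < r <= s) <= L)%N.
Proof.
elim: L r => [|L IH] r; first by rewrite expn0 big_ord1 /= leqn0; lia.
(* Separates the even nodes, which go to the induction hypothesis, from the odd ones, which
   contribute at most 1. *)
have split2 n (F : nat -> nat) :
    (\sum_(s < 2 * n) F s = \sum_(k < n) (F k.*2 + F k.*2.+1))%N.
  elim: n => [|n IHn]; first by rewrite muln0 !big_ord0.
  by rewrite mulnS !big_ord_recr /= IHn -!addnA mul2n.
rewrite expnS (split2 _ (fun s => (fenwick_low L.+1 s < r <= s)%N : nat)) big_split /=.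
rewrite -[leqRHS]addn1; apply: leq_add.
  apply: leq_trans (IH (uphalf r)); apply: leq_sum => k _.
  by rewrite odd_double doubleK; lia.
have sum1 n c : (\sum_(k < n) (val k == c) = (c < n))%N.
  by elim: n => [|n IHn]; rewrite ?big_ord0// big_ord_recr /= IHn; lia.
apply: (@leq_trans (r./2 < 2 ^ L)%N); last exact: leq_b1.
by rewrite -sum1; apply: leq_sum => k _; rewrite odd_double /=; lia.
Qed.

Lemma fenwick_low_le L t : (fenwick_low L t <= t)%N.
Proof.
elim: L t => //= L IH t; case: ifP => _; first exact: leq_pred.
by have := IH t./2; lia.
Qed.

(** A flat noise vector consists of T blocks of D entries; this counts it block by block. *)
Lemma sum_divn D (F : nat -> nat) T : (0 < D)%N ->
  (\sum_(k < T * D) F (k %/ D) = D * \sum_(t < T) F t)%N.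
Proof.
move=> D0; elim: T => [|T IH]; first by rewrite mul0n !big_ord0 muln0.
rewrite big_ord_recr mulnDr -IH -!(big_mkord predT (fun k => F (k %/ D)%N)) /=.
rewrite (@big_cat_nat _ _ _ (T * D)%N) ?leq_mul2r ?leqnSn ?orbT//=; congr addn.
rewrite big_nat (eq_bigr (fun _ => F T)); last first.
  move=> k /andP[k1 k2]; congr F; apply/eqP.
  by rewrite eqn_leq leq_divRL// k1 andbT -ltnS ltn_divLR.
by rewrite -big_nat sum_nat_const_nat mulSn addnK.
Qed.

Lemma leq_sum_ord_succ (F : nat -> nat) m n : (m < n)%N ->
  (\sum_(t < m) F t.+1 <= \sum_(t < n) F t)%N.
Proof.
case: n => // n mn; rewrite (big_ord_widen n (fun t => F t.+1))// big_mkcond.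
rewrite big_ord_recl; apply: leq_trans (leq_addl _ _).
by apply: leq_sum => t _; case: ifP.
Qed.

Lemma big_mkseq (V I : Type) (idx : V) (op : V -> V -> V) (f : nat -> I) n
    (P : pred I) (F : I -> V) :
  \big[op/idx]_(x <- mkseq f n | P x) F x =
  \big[op/idx]_(q < n | P (f q)) F (f q).
Proof.
by rewrite big_map -(big_mkord (P \o f) (F \o f)) /index_iota subn0.
Qed.

(** * Transcripts as functions of the answers *)

Lemma unzip1_play M A (next : seq (M * A) -> M) (ans : seq M -> A) n :
  unzip1 (play next ans n) = mkseq (fun q => next (play next ans q)) n.
Proof.
elim: n => //= n IH.
by rewrite /unzip1 map_rcons -/(unzip1 _) IH mkseqS.
Qed.

(** The two answer functions are compared only on the message lists that arise in the play against
    [ans']; elsewhere they may differ. *)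
Lemma eq_play_on M A (next : seq (M * A) -> M) (ans ans' : seq M -> A) n :
  (forall m, (m <= n)%N ->
     ans (mkseq (fun q => next (play next ans' q)) m) =
     ans' (mkseq (fun q => next (play next ans' q)) m)) ->
  play next ans n = play next ans' n.
Proof.
elim: n => //= n IH H; rewrite IH => [|m mn]; last by apply: H; exact: leqW.
by congr (rcons _ (_, _)); have := H n.+1 (leqnn _); rewrite mkseqS -unzip1_play.
Qed.

(* Entry (r - 1) * D + j of z is the noise of coordinate j at node r >= 1. *)
Definition tree_noise (R : realType) (L D : nat) (z : seq R) (t j : nat) : R :=
  \sum_(r <- fenwick_chain L t) nth 0 z (r.-1 * D + j)%N.

Definition noisy_sums (R : realType) (L d : nat) (z : seq R)
    (xs : seq (record d)) (j : 'I_d) : R :=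
  (colsum xs j)%:R + tree_noise L d z (size xs) j.

Lemma measurable_noisy_sums (R : realType) (L d n : nat)
    (xs : seq (record d)) (j : 'I_d) :
  measurable_fun setT (fun z : n.-tuple R => noisy_sums L z xs j).
Proof.
apply: measurable_funD => //; apply: measurable_sum => r.
exact: measurable_nth_tuple.
Qed.

(** * The tree mechanism and its privacy *)

Section tree_mechanism.
Context (R : realType) (s : R) (T L d : nat) dA (A : measurableType dA).
Variable post : ('I_d.+1 -> R) -> A.
Local Notation D := d.+1.
Local Notation N := (T * D)%N.
Hypothesis mpost : forall xs : seq (record D),
  measurable_fun setT (fun z : N.-tuple R => post (noisy_sums L z xs)).

(** The output map [post] stays abstract, so that one privacy proof serves both problems. *)
Definition tree_mechanism : mechanism R (record D) A :=
  Mechanism (gauss_vec s N) mpost.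

Section privacy.
Variables (a b : side) (Adv : adversary R (message (record D)) A).
Hypothesis TL : (T < 2 ^ L)%N.

Let ans c (z : seq R) (ms : seq (message (record D))) : A :=
  post (noisy_sums L z (map (@sent_on _ c) ms)).

(** Messages are always taken from the play on side [b] with unshifted noise; side [a] with shifted
    noise is shown to send the same ones. *)
Let msg (w : adv_coins Adv) (z : seq R) (q : nat) : discrete (message (record D)) :=
  adv_next w (play (adv_next w) (ans b z) q).

Let diff (m : discrete (message (record D))) (j : 'I_D) : R :=
  (tnth (sent_on b m) j)%:R - (tnth (sent_on a m) j)%:R.

Let gap w z (j : 'I_D) n : R := \sum_(q < n) diff (msg w z q) j.

Let coord (k : nat) : 'I_D := Ordinal (ltn_pmod k (ltn0Sn d)).

(* Shifting the noise of side a by delta compensates the difference between the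
   node sums of the two sides. *)
Let delta w (k : nat) (z : N.-tuple R) : R :=
  gap w z (coord k) (k %/ D).+1 -
  gap w z (coord k) (fenwick_low L (k %/ D).+1).

Let measurable_delta k :
  measurable_fun setT (fun zw : N.-tuple R * adv_coins Adv => delta zw.2 k zw.1).
Proof.
suff mgap j n : measurable_fun setT
    (fun zw : N.-tuple R * adv_coins Adv => gap zw.2 zw.1 j n).
  by apply: measurable_funB.
apply: measurable_sum => q.
pose m (zw : mech_coins tree_mechanism * adv_coins Adv) : discrete (message (record D)) :=
  adv_next zw.2 (transcript (@sent_on _ b) tree_mechanism Adv q zw).
have mm : measurable_fun setT m.
  have mh : measurable_fun setT (fun zw =>
      (zw.2, transcript (@sent_on _ b) tree_mechanism Adv q zw)).
    by apply: measurable_fun_pair => //; exact: measurable_transcript.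
  exact: (measurableT_comp (measurable_adv_next Adv q) mh).
by apply: (@measurableT_comp _ _ _ _ _ _ (diff^~ j) _ m).
Qed.

(** Message [q], counted from 0, depends on answers to at most [q] records. Their chains contain
    nodes r <= q, whose noise entries have indices below q * D <= k. *)
Let eq_msg w (z z' : N.-tuple R) q k : (q <= k %/ D)%N -> take k z = take k z' ->
  msg w z q = msg w z' q.
Proof.
move=> qk zz; congr adv_next; apply: eq_play_on => m mq; move: (mkseq _ m) (size_mkseq
  (fun q => adv_next w (play (adv_next w) (ans b z') q)) m) => ms szms.
congr post; apply/funext => j; congr (_ + _); rewrite size_map /tree_noise.
rewrite big_seq [RHS]big_seq; apply: eq_bigr => r /mem_fenwick_chain /andP[r0 rn].
suff rk : (r.-1 * D + j < k)%N by rewrite -(nth_take _ rk) zz nth_take.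
have : (r * D <= k)%N.
  by rewrite -leq_divRL//; apply: leq_trans qk; apply: leq_trans mq; rewrite -szms.
by case: r r0 {rn} => // r _; rewrite mulSn; have := ltn_ord j; lia.
Qed.

(** Entry [k] belongs to node k / D + 1, whose sum involves the messages up to number k / D, counted
    from 0; [eq_msg] covers exactly these. *)
Let adapted_delta w : adapted (delta w).
Proof.
move=> k z z' zz.
have eq_gap n j : (n <= (k %/ D).+1)%N -> gap w z j n = gap w z' j n.
  move=> nk; apply: eq_bigr => q _; rewrite (@eq_msg w z z' q k)//.
  by have := ltn_ord q; lia.
by rewrite /delta !eq_gap// fenwick_low_le.
Qed.

(** Along the chain of [n] the shifts telescope to [gap n], the amount by which the column sum of
    side [b] exceeds that of side [a]. *)
Let eq_ans w (z : N.-tuple R) n : (n <= T)%N ->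
  ans a (shift_vec (delta w) z) (mkseq (msg w z) n) =
  ans b z (mkseq (msg w z) n).
Proof.
move=> nT; congr post; apply/funext => j.
rewrite /noisy_sums !size_map size_iota.
have colE c : (colsum (map (@sent_on _ c) (mkseq (msg w z) n)) j)%:R =
    \sum_(q < n) (tnth (sent_on c (msg w z q)) j)%:R :> R.
  by rewrite /colsum big_map big_mkseq natr_sum.
rewrite !colE.
suff -> : tree_noise L D (shift_vec (delta w) z) n j =
    tree_noise L D z n j + gap w z j n.
  by rewrite /gap /diff sumrB; ring.
(* The empty sum [gap 0] is subtracted to obtain the telescoped form. *)
have -> : gap w z j n = gap w z j n - gap w z j 0%N.
  by rewrite {3}/gap big_ord0 subr0.
rewrite -(@sum_fenwick_chain _ (gap w z j) L n) ?(leq_ltn_trans nT)//.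
move Ezs : (shift_vec (delta w) z) => zs; rewrite /tree_noise -big_split/= big_seq [RHS]big_seq.
apply: eq_bigr => r /mem_fenwick_chain /andP[r0 rn].
have rN : (r.-1 * D + j < N)%N.
  have : (r * D <= N)%N by rewrite leq_mul2r (leq_trans rn nT) orbT.
  by case: r r0 {rn} => // r _; rewrite mulSn; have := ltn_ord j; lia.
have nE (t : N.-tuple R) : nth 0 t (r.-1 * D + j)%N = tnth t (Ordinal rN).
  by rewrite (tnth_nth 0).
rewrite !nE -Ezs tnth_mktuple.
congr (_ + _); rewrite /delta divnMDl// divn_small// addn0 prednK//.
have -> : coord (r.-1 * D + j)%N = j.
  by apply: val_inj; rewrite /= modnMDl modn_small.
by [].
Qed.

Let shifted_transcript w (z : N.-tuple R) n : (n <= T)%N ->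
  play (adv_next w) (ans a (shift_vec (delta w) z)) n =
  play (adv_next w) (ans b z) n.
Proof.
move=> nT; apply: eq_play_on => m mn; apply: eq_ans.
exact: leq_trans nT.
Qed.

(** A shift is nonzero only at nodes covering the challenge step, and then at most 1 in absolute
    value. At most L nodes cover that step, each with D coordinates. *)
Let sum_delta_le w (z : N.-tuple R) :
  one_challenge T Adv -> \sum_(k < N) delta w k z ^+ 2 <= (D * L)%:R.
Proof.
move=> one.
pose c q : nat := is_challenge (msg w z q).
have c1 : (\sum_(q < T) c q = 1)%N.
  have := one w (ans b z); rewrite unzip1_play -sum1_count big_mkseq big_mkcond.
  move=> <-.
  by apply: eq_bigr => q _; rewrite /c; case: is_challenge.
have dc q j : `|diff (msg w z q) j| <= (c q)%:R.
  rewrite /diff /c; case: (msg w z q) => [x|xL xR] /=; first by rewrite subrr normr0.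
  by case: (tnth _ j); case: (tnth _ j);
    rewrite ?subrr ?normr0 ?sub0r ?subr0 ?normrN ?normr1.
(* As sum c = 1, each node sum of c is 0 or 1, hence equal to its square. *)
have step k : (k < N)%N -> delta w k z ^+ 2 <=
    (\sum_(q < T) c q * (fenwick_low L (k %/ D).+1 < q.+1 <= (k %/ D).+1))%N%:R.
  move=> kN; set r := (k %/ D)%N.+1; set j := coord k.
  have rT : (r <= T)%N by rewrite /r ltn_divLR.
  pose S := (\sum_(fenwick_low L r <= q < r) c q)%N.
  have SE : (S = \sum_(q < T) c q * (fenwick_low L r < q.+1 <= r))%N.
    rewrite /S (big_nat_widen _ _ T)// (big_nat_widenl _ 0)// big_mkord big_mkcond.
    apply: eq_bigr => q _; rewrite /= [X in if X then _ else _]andbC ltnS.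
    by case: (_ && _); rewrite ?muln1 ?muln0.
  have S1 : (S <= 1)%N.
    by rewrite SE -c1; apply: leq_sum => q _; case: (_ <= _ <= _)%N; rewrite ?muln1 ?muln0.
  have dS : `|delta w k z| <= S%:R.
    rewrite /delta -/r -/j /gap -!(big_mkord predT (fun q => diff (msg w z q) j)).
    rewrite (@big_cat_nat _ _ _ (fenwick_low L r)) ?fenwick_low_le//= addrAC subrr add0r.
    by rewrite (le_trans (ler_norm_sum _ _ _))// natr_sum ler_sum.
  rewrite -SE -real_normK ?num_real//.
  have : S%:R ^+ 2 = S%:R :> R by case: S S1 {SE dS} => [|[]]; rewrite ?expr0n ?expr1n.
  by move=> <-; rewrite lerXn2r ?nnegrE.
apply: le_trans (ler_sum _ (fun (k : 'I_N) _ => step k (ltn_ord k))) _.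
rewrite -natr_sum ler_nat exchange_big /=.
apply: (@leq_trans (\sum_(q < T) c q * (D * L))).
  apply: leq_sum => q _; rewrite -big_distrr leq_mul2l; apply/orP; right.
  rewrite (sum_divn (fun t => (fenwick_low L t.+1 < q.+1 <= t.+1)%N : nat))// leq_mul2l /=.
  apply: leq_trans (fenwick_low_coverage L q.+1).
  exact: (leq_sum_ord_succ (fun t => (fenwick_low L t < q.+1 <= t)%N : nat)).
by rewrite -big_distrl /= c1 mul1n.
Qed.

Lemma tree_mechanism_renyi (xi : R) : s != 0 -> 1 < xi -> one_challenge T Adv ->
  (renyi_divergence xi (view_law (sent_on a) tree_mechanism Adv T)
     (view_law (sent_on b) tree_mechanism Adv T) <=
   (xi * ((D * L)%:R / (2 * s ^+ 2)))%:E)%E.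
Proof.
move=> s0 xi1 one.
apply: (@renyi_divergence_adaptive_shift _ _ _ _ _ _ _ _ _ _ _ _ delta) => //.
  by move=> w z; exact: sum_delta_le.
move=> w z; congr (_, _); apply: val_inj; exact: shifted_transcript.
Qed.

End privacy.

Lemma tree_mechanism_zCDP (rho : R) : s != 0 -> (T < 2 ^ L)%N ->
  (D * L)%:R / (2 * s ^+ 2) <= rho -> zCDP T rho tree_mechanism.
Proof.
move=> s0 TL hrho Adv one /= xi xi1.
(* The two sides are arbitrary in [tree_mechanism_renyi], which therefore gives both directions. *)
by split; (apply: le_trans (tree_mechanism_renyi _ _ TL s0 xi1 one) _);
  rewrite lee_fin ler_pM2l//; lra.
Qed.

End tree_mechanism.

(** * Accuracy from an event of the mechanism's coins *)

Lemma nth_play_answer M A (x0 : M * A) (next : seq (M * A) -> M)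
    (ans : seq M -> A) n t : (t < n)%N ->
  (nth x0 (play next ans n) t).2 = ans (take t.+1 (unzip1 (play next ans n))).
Proof.
elim: n => // n IH; rewrite ltnS => tn /=.
have sz := eqP (size_play next ans n).
rewrite nth_rcons sz /unzip1 map_rcons -/(unzip1 _) /=.
have [tn'|nt] := ltnP t n.
  by rewrite IH// -cats1 takel_cat// size_map sz.
have -> : t = n by lia.
by rewrite eqxx take_oversize// size_rcons size_map sz.
Qed.

(** On [G] the error is small for every list of records at once, hence for any list an adaptive
    adversary produces; the product of [G] with all adversary coins has the probability of [G]. *)
Lemma accurate_good_event (R : realType) d dA (A : measurableType dA)
    (err : seq (record d) -> A -> R) (T : nat) (alpha : R)
    (Mech : mechanism R (record d) A) (G : set (mech_coins Mech)) :
  0 <= alpha -> (forall xs, measurable_fun setT (err xs)) ->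
  measurable G -> ((2 / 3)%:E <= mech_prob Mech G)%E ->
  (forall z xs, G z -> (size xs <= T)%N -> err xs (mech_out z xs) <= alpha) ->
  accurate err T alpha Mech.
Proof.
move=> a0 merr mG PG Gerr Adv.
pose f (t : 'I_T) (w : mech_coins Mech * adv_coins Adv) : R :=
  let h := transcript id Mech Adv T w in
  err (take t.+1 (unzip1 h)) (tnth h t).2.
have mf t : measurable_fun setT (f t).
  (* [err xs] is measurable for each fixed [xs], so the finitely many possible lists of records are
     distinguished. *)
  apply: (@measurable_finite_case _ _ _ _ (T.-tuple (record d))
    (fun w => map_tuple fst (transcript id Mech Adv T w))
    (fun k w => err (take t.+1 k) (tnth (transcript id Mech Adv T w) t).2)).
    move=> k; rewrite (_ : [set _ | _] = \bigcap_(i in [set: 'I_T])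
      [set w | (tnth (transcript id Mech Adv T w) i).1 = tnth k i]); last first.
      apply/seteqP; split => [w /= <- i _|w /= H]; first by rewrite tnth_map.
      by apply: eq_from_tnth => i; rewrite tnth_map; exact: H.
    apply: fin_bigcap_measurable => [|i _]; first exact: finite_finset.
    have mi : measurable_fun setT (fun w : mech_coins Mech * adv_coins Adv =>
        (tnth (transcript id Mech Adv T w) i).1).
      apply: measurableT_comp => //; apply: (measurableT_comp (measurable_tnth i)).
      exact: measurable_transcript.
    have := mi measurableT [set tnth k i] I; rewrite setTI; exact.
  move=> k; apply: measurableT_comp => //; apply: measurableT_comp => //.
  apply: (measurableT_comp (measurable_tnth t)).
  exact: measurable_transcript.
set E := (X in (_ <= _ X)%E).
have EE : E = \bigcap_(t in [set: 'I_T]) [set w | f t w <= alpha].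
  apply/seteqP; split => [w|w H] /=.
    move=> wE t _ /=; apply: le_trans wE.
    exact: (le_bigmax _ (fun t => f t w)).
  apply/bigmax_leP; split => // t _; exact: H.
have mE : measurable E.
  rewrite EE; apply: fin_bigcap_measurable => [|t _]; first exact: finite_finset.
  rewrite (_ : [set _ | _] = f t @^-1` `]-oo, alpha]); last first.
    by apply/seteqP; split => w; rewrite /= in_itv.
  by rewrite -[X in measurable X]setTI; exact: mf.
apply: (@le_trans _ _ ((mech_prob Mech \x adv_prob Adv)%E (G `*` setT))).
  rewrite product_measure1E// [X in (_ <= _ * X)%E](_ : _ = 1%E) ?mule1//.
  exact: probability_setT.
apply: le_measure; rewrite ?inE//; first exact: measurableX.
move=> [z w] [/= Gz _]; rewrite EE => t _ /=.
have -> : f t (z, w) = err (take t.+1 (unzip1 (transcript id Mech Adv T (z, w))))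
    (mech_out z (take t.+1 (unzip1 (transcript id Mech Adv T (z, w))))).
  rewrite /f /=; congr err.
  rewrite (tnth_nth (point, mech_out z [::])) nth_play_answer//.
  by rewrite map_id.
by apply: Gerr => //; rewrite size_take size_map size_tuple; case: ifP => // /ltnW.
Qed.

(** * Selection of an index of maximal noisy sum *)

(** The choice depends on [v] through finitely many comparisons only; factoring it through this
    finite key makes it measurable. *)
Definition select_key (R : realType) n (v : 'I_n.+1 -> R) :
    {ffun 'I_n.+1 * 'I_n.+1 -> bool} :=
  [ffun p => v p.1 <= v p.2].

Definition select_of_key n (k : {ffun 'I_n.+1 * 'I_n.+1 -> bool}) : 'I_n.+1 :=
  odflt ord0 [pick i | [forall j, k (j, i)]].

Definition select (R : realType) n (v : 'I_n.+1 -> R) : discrete 'I_n.+1 :=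
  select_of_key (select_key v).

Lemma le_select (R : realType) n (v : 'I_n.+1 -> R) j : v j <= v (select v).
Proof.
rewrite /select /select_of_key; case: pickP => [i /forallP/(_ j)|/=].
  by rewrite ffunE.
(* A maximizer exists, so the default [ord0] of [select_of_key] is never taken for such a key. *)
pose i0 := [arg max_(i > ord0) v i]%O.
move=> /(_ i0) /negP[]; apply/forallP => i; rewrite ffunE /= /i0.
by case: arg_maxP => // k _; apply.
Qed.

Lemma measurable_select (R : realType) n d (W : measurableType d)
    dA (A : measurableType dA) (v : W -> 'I_n.+1 -> R) (g : 'I_n.+1 -> W -> A) :
  (forall j, measurable_fun setT (fun w => v w j)) ->
  (forall j, measurable_fun setT (g j)) ->
  measurable_fun setT (fun w => g (select (v w)) w).
Proof.
move=> mv mg; apply: (@measurable_finite_case _ _ _ _ _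
  (fun w => select_key (v w)) (fun k w => g (select_of_key k) w)) => // k.
rewrite (_ : [set _ | _] = \bigcap_(p in [set: 'I_n.+1 * 'I_n.+1])
   ((fun w => v w p.1 <= v w p.2) @^-1` [set k p])).
  apply: fin_bigcap_measurable => [|p _]; first exact: finite_finset.
  by rewrite -[X in measurable X]setTI; apply: measurable_fun_ler.
apply/seteqP; split => [w /= <- p _|w /= H]; first by rewrite /= ffunE.
by apply/ffunP => p; rewrite ffunE; exact: H.
Qed.

Lemma MaxSum_attained d (xs : seq (record d.+1)) :
  exists j, MaxSum xs = colsum xs j.
Proof. by have [|j] := bigop.eq_bigmax (colsum xs); [rewrite card_ord|exists j]. Qed.

Lemma colsum_le_MaxSum d (xs : seq (record d)) j : (colsum xs j <= MaxSum xs)%N.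
Proof. exact: (bigop.leq_bigmax (F := colsum xs)). Qed.

Section select_error.
Context (R : realType) (d : nat) (xs : seq (record d.+1)).
Variables (v : 'I_d.+1 -> R) (a : R).
Hypothesis va : forall j, `|v j - (colsum xs j)%:R| <= a.

(** The selected value is at least the noisy value at a true maximizer, and at most [a] above the
    true sum of the selected index. *)
Lemma err_MaxSum_select : err_MaxSum xs (v (select v)) <= a.
Proof.
have [j jE] := MaxSum_attained xs.
have := va j; have := va (select v); have := le_select v j; rewrite /err_MaxSum.
have : (colsum xs (select v))%:R <= (MaxSum xs)%:R :> R.
  by rewrite ler_nat colsum_le_MaxSum.
rewrite jE !ler_distl; lra.
Qed.

(** The deviation [a] is paid twice, at a true maximizer and at the selected index. *)
Lemma err_SumSelect_select : @err_SumSelect R _ xs (select v) <= 2 * a.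
Proof.
have [j jE] := MaxSum_attained xs.
have := va j; have := va (select v); have := le_select v j; rewrite /err_SumSelect.
rewrite jE !ler_distl; lra.
Qed.

End select_error.

(** * Union bound over times and coordinates *)

(** Distinct nodes of a chain read distinct noise entries, and there are at most L of them. *)
Lemma tree_noise_tail (R : realType) (s a : R) (L D T t j : nat) :
  0 < s -> 0 <= a -> (0 < L)%N -> (j < D)%N -> (t <= T)%N ->
  (gauss_vec s (T * D) [set z : (T * D).-tuple R | (`|tree_noise L D z t j| > a)%R]%classic <=
   (2 * expR (- (a ^+ 2 / (2 * L%:R * s ^+ 2))))%:E)%E.
Proof.
move=> s0 a0 L0 jD tT.
pose l := [seq (r.-1 * D + j)%N | r <- fenwick_chain L t].
rewrite (_ : [set z | _]%classic =
    [set z : (T * D).-tuple R | (`|\sum_(k <- l) nth 0 z k| > a)%R]%classic); last first.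
  by apply/seteqP; split => z; rewrite /= /tree_noise /l big_map.
apply: gauss_vec_tail => //.
- rewrite map_inj_in_uniq ?uniq_fenwick_chain// => r r'.
  move=> /mem_fenwick_chain/andP[r0 _] /mem_fenwick_chain/andP[r'0 _] /addIn /eqP.
  by rewrite eqn_mul2r; lia.
- apply/allP => _ /mapP[r /mem_fenwick_chain/andP[r0 rt] ->] /=.
  have : (r * D <= T * D)%N by rewrite leq_mul2r (leq_trans rt tT) orbT.
  by case: r r0 {rt} => // r _; rewrite mulSn; lia.
- by rewrite size_map size_fenwick_chain.
Qed.

(** One index [k] encodes a pair: the time k / D + 1, from 1 to T, and the coordinate k mod D. *)
Definition small_noise (R : realType) (L D T : nat) (a : R) : set ((T * D).-tuple R) :=
  [set z | forall k, (k < T * D)%N ->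
     `|tree_noise L D z (k %/ D)%N.+1 (k %% D)%N| <= a].

Arguments small_noise {R} L D T a.

Lemma measurable_tree_noise (R : realType) L D n t j :
  measurable_fun setT (fun z : n.-tuple R => tree_noise L D z t j).
Proof. by apply: measurable_sum => r; exact: measurable_nth_tuple. Qed.

Lemma measurable_small_noise (R : realType) (L D T : nat) (a : R) :
  measurable (small_noise L D T a).
Proof.
rewrite (_ : small_noise _ _ _ _ = \bigcap_(k in [set: 'I_(T * D)])
  ((fun z : (T * D).-tuple R => `|tree_noise L D z (k %/ D)%N.+1 (k %% D)%N|) @^-1` `]-oo, a])).
  apply: fin_bigcap_measurable => [|k _]; first exact: finite_finset.
  rewrite -[X in measurable X]setTI; apply: measurableT_comp => //.
  exact: measurable_tree_noise.
apply/seteqP; split => [z H k _|z H k kN]; rewrite /= ?in_itv/=; first exact: H.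
by have := H (Ordinal kN) I; rewrite /= in_itv.
Qed.

Lemma small_noise_prob (R : realType) (s a : R) (L D T : nat) :
  0 < s -> 0 <= a -> (0 < L)%N -> (0 < D)%N ->
  (T * D)%:R * (2 * expR (- (a ^+ 2 / (2 * L%:R * s ^+ 2)))) <= 3^-1 ->
  ((2 / 3)%:E <= gauss_vec s (T * D) (small_noise L D T a))%E.
Proof.
move=> s0 a0 L0 D0 H.
have mS := @measurable_small_noise R L D T a.
rewrite -[small_noise _ _ _ _]setCK probability_setC; last exact: measurableC.
suff : (gauss_vec s (T * D) (~` small_noise L D T a) <= (3^-1)%:E)%E.
  have Pfin : gauss_vec s (T * D) (~` small_noise L D T a) \is a fin_num.
    by rewrite fin_num_measure//; exact: measurableC.
  by rewrite -(fineK Pfin) -EFinB !lee_fin; lra.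
pose B k := [set z : (T * D).-tuple R |
  (`|tree_noise L D z (k %/ D)%N.+1 (k %% D)%N| > a)%R]%classic.
have mB k : measurable (B k).
  rewrite [B k](_ : _ = (fun z : (T * D).-tuple R =>
     `|tree_noise L D z (k %/ D)%N.+1 (k %% D)%N|) @^-1` `]a, +oo[).
    rewrite -[X in measurable X]setTI; apply: measurableT_comp => //.
    exact: measurable_tree_noise.
  by apply/seteqP; split => z; rewrite /B /= in_itv/= andbT.
apply: (@le_trans _ _ (\sum_(k < T * D) gauss_vec s (T * D) (B k))%E).
  apply: content_subadditive => //; first exact: measurableC.
  move=> z /existsNP[k /not_implyP[kN /negP]]; rewrite -ltNge => Hk.
  by rewrite -bigcup_mkord; exists k.
apply: (@le_trans _ _ (\sum_(k < T * D)
    (2 * expR (- (a ^+ 2 / (2 * L%:R * s ^+ 2))))%:E)%E).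
  apply: lee_sum => k _; apply: tree_noise_tail => //; first by rewrite ltn_mod.
  by rewrite ltn_divLR.
rewrite sumEFin lee_fin sumr_const card_ord -[leLHS]mulr_natl; exact: H.
Qed.

Lemma noisy_sums_close (R : realType) (L T d : nat) (a : R) (z : (T * d.+1).-tuple R)
    (xs : seq (record d.+1)) j :
  0 <= a -> small_noise L d.+1 T a z -> (size xs <= T)%N ->
  `|noisy_sums L z xs j - (colsum xs j)%:R| <= a.
Proof.
move=> a0 Hz szT; rewrite /noisy_sums addrAC subrr add0r.
(* [small_noise] speaks of times from 1 on; at time 0 the chain is empty and there is no noise. *)
case E : (size xs) szT => [|n] szT.
  rewrite /tree_noise big_seq big1 ?normr0// => r.
  by move=> /mem_fenwick_chain; case: r.
have := Hz (n * d.+1 + j)%N.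
rewrite divnMDl// divn_small// addn0 modnMDl modn_small//; apply.
by apply: (@leq_trans (n.+1 * d.+1)); rewrite ?leq_mul2r ?szT ?orbT// mulSn addnC ltn_add2r.
Qed.

(** * Calibration of the noise *)

Lemma ln2_gt0 (R : realType) : 0 < ln 2 :> R.
Proof. by rewrite ln_gt0// ltr1n. Qed.

(** As T >= 2, the truncated logarithm is at least 1, so adding 1 at most doubles it. *)
Lemma trunc_log_le_ln (R : realType) T : (2 <= T)%N ->
  (trunc_log 2 T).+1%:R <= 2 / ln 2 * ln T%:R :> R.
Proof.
move=> T2; have ln20 := ln2_gt0 R.
have Tpos : 0 < T%:R :> R by rewrite ltr0n; lia.
have l1 : 1 <= (trunc_log 2 T)%:R :> R by rewrite ler1n trunc_log_gt0.
have lT : (trunc_log 2 T)%:R * ln 2 <= ln T%:R :> R.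
  rewrite mulr_natl -lnXn// ler_ln ?posrE ?exprn_gt0// -natrX ler_nat.
  by apply: trunc_logP => //; lia.
rewrite -natr1 mulrAC ler_pdivlMr//.
by move: (trunc_log 2 T)%:R l1 lT => x l1 lT; nra.
Qed.

(** The solution s of D L / (2 s^2) = rho. *)
Definition noise_scale (R : realType) (rho : R) (D L : nat) : R :=
  Num.sqrt ((D * L)%:R / (2 * rho)).

(** The solution a of a^2 / (2 L s^2) = ln (6 T D) for this s; the union bound over T D events of
    probability at most 2 / (6 T D) then gives 1/3. *)
Definition noise_bound (R : realType) (rho : R) (D L T : nat) : R :=
  L%:R * (Num.sqrt D%:R * Num.sqrt (ln (6 * (T * D)%:R)) / Num.sqrt rho).

Section calibration.
Context (R : realType) (rho : R) (D L T : nat).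
Hypotheses (rho0 : 0 < rho) (D0 : (0 < D)%N) (L0 : (0 < L)%N) (T6 : (6 <= T)%N).
Local Notation s := (noise_scale rho D L).
Local Notation a := (noise_bound rho D L T).

Lemma noise_scale_gt0 : 0 < s.
Proof. by rewrite sqrtr_gt0 divr_gt0 ?mulr_gt0// ltr0n muln_gt0 D0. Qed.

Lemma sqr_noise_scale : s ^+ 2 = (D * L)%:R / (2 * rho).
Proof. by rewrite sqr_sqrtr// divr_ge0// mulr_ge0// ltW. Qed.

Lemma noise_scale_privacy : (D * L)%:R / (2 * s ^+ 2) = rho.
Proof.
have Lneq : L%:R != 0 :> R by rewrite pnatr_eq0 -lt0n.
have Dneq : D%:R != 0 :> R by rewrite pnatr_eq0 -lt0n.
by rewrite sqr_noise_scale natrM; field; rewrite Lneq Dneq gt_eqF.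
Qed.

Lemma noise_bound_ge0 : 0 <= a.
Proof. by rewrite mulr_ge0// divr_ge0// mulr_ge0. Qed.

Let TD : 6 <= (T * D)%:R :> R.
Proof. by rewrite (ler_nat R 6) (leq_trans T6)// leq_pmulr. Qed.

Lemma noise_bound_tail :
  (T * D)%:R * (2 * expR (- (a ^+ 2 / (2 * L%:R * s ^+ 2)))) <= 3^-1.
Proof.
have Lneq : L%:R != 0 :> R by rewrite pnatr_eq0 -lt0n.
have Dneq : D%:R != 0 :> R by rewrite pnatr_eq0 -lt0n.
have ln6 : 0 <= ln (6 * (T * D)%:R) :> R by apply: ln_ge0; move: TD; move: (T * D)%:R => x hx; lra.
have -> : a ^+ 2 / (2 * L%:R * s ^+ 2) = ln (6 * (T * D)%:R).
  rewrite sqr_noise_scale /noise_bound !exprMn exprVn !sqr_sqrtr// ?ltW//.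
  by rewrite natrM; field; rewrite Lneq Dneq gt_eqF.
rewrite expRN lnK ?posrE; last by move: TD; move: (T * D)%:R => x hx; lra.
rewrite le_eqVlt; apply/orP; left; apply/eqP.
by move: TD; move: (T * D)%:R => x hx; field; rewrite gt_eqF//; lra.
Qed.

(** Since 6 <= T D, ln (6 T D) is at most 2 ln (T D), whence the factor sqrt 2. *)
Lemma noise_bound_le :
  a <= L%:R * Num.sqrt 2 * (Num.sqrt D%:R * Num.sqrt (ln (D * T)%N%:R)) / Num.sqrt rho.
Proof.
have TDln : 0 < ln (T * D)%:R :> R by apply: ln_gt0; move: TD; move: (T * D)%:R => x hx; lra.
rewrite /noise_bound -!mulrA ler_wpM2l// [leRHS]mulrCA ler_wpM2l//.
rewrite mulrA ler_wpM2r ?invr_ge0// -sqrtrM// ler_sqrt; last by rewrite pmulr_rge0// ltW// mulnC.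
have : ln 6 <= ln (T * D)%:R :> R.
  by move: TD; move: (T * D)%:R => x hx; rewrite ler_ln ?posrE; lra.
move: TD; rewrite (mulnC D T); move: (T * D)%:R => x hx.
by rewrite lnM ?posrE; lra.
Qed.

End calibration.

(** * The two mechanisms and their accuracy *)

Definition post_max (R : realType) d (v : 'I_d.+1 -> R) : R := v (select v).

Lemma measurable_post_max (R : realType) (L d n : nat) (xs : seq (record d.+1)) :
  measurable_fun setT (fun z : n.-tuple R => post_max (noisy_sums L z xs)).
Proof.
apply: (measurable_select (v := fun (z : n.-tuple R) => noisy_sums L z xs)
  (g := fun j (z : n.-tuple R) => noisy_sums L z xs j)) => j;
  exact: measurable_noisy_sums.
Qed.

Lemma measurable_post_select (R : realType) (L d n : nat) (xs : seq (record d.+1)) :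
  measurable_fun setT
    (fun z : n.-tuple R => select (noisy_sums L z xs) : discrete 'I_d.+1).
Proof.
apply: (measurable_select (v := fun (z : n.-tuple R) => noisy_sums L z xs)
  (g := fun j (z : n.-tuple R) => j : discrete 'I_d.+1)) => j //.
exact: measurable_noisy_sums.
Qed.

Lemma measurable_err_MaxSum (R : realType) d (xs : seq (record d)) :
  measurable_fun setT (@err_MaxSum R d xs).
Proof. by apply: measurableT_comp => //; apply: measurable_funB. Qed.

Lemma tree_mechanism_accurate (R : realType) (s a alpha : R) (T L d : nat)
    dA (A : measurableType dA) (post : ('I_d.+1 -> R) -> A)
    (mpost : forall xs : seq (record d.+1), measurable_fun setT
       (fun z : (T * d.+1).-tuple R => post (noisy_sums L z xs)))
    (err : seq (record d.+1) -> A -> R) :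
  0 <= a -> 0 <= alpha -> (forall xs, measurable_fun setT (err xs)) ->
  ((2 / 3)%:E <= gauss_vec s (T * d.+1) (small_noise L d.+1 T a))%E ->
  (forall xs v, (forall j, `|v j - (colsum xs j)%:R| <= a) ->
     err xs (post v) <= alpha) ->
  accurate err T alpha (tree_mechanism s mpost).
Proof.
move=> a0 alpha0 merr PG Herr.
apply: (@accurate_good_event _ _ _ _ _ _ _ (tree_mechanism s mpost)
  (small_noise L d.+1 T a)) => //; first exact: measurable_small_noise.
by move=> z xs Gz szT; apply: Herr => j; exact: noisy_sums_close.
Qed.

Unset Implicit Arguments.

(* The dimension is d.+1, so that it is positive. *)
Theorem theorem5p5 (R : realType) :
  exists (C : R) (T0 : nat), 0 < C /\
    forall (rho : R) (d T : nat), 0 < rho <= 1 -> (T0 <= T)%N ->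
      exists alpha : R,
        `|alpha| <= C * (Num.sqrt d.+1%:R * ln T%:R *
                         Num.sqrt (ln (d.+1 * T)%N%:R) / Num.sqrt rho) /\
        (exists M : mechanism R (record d.+1) R,
           zCDP T rho M /\ accurate (@err_MaxSum R d.+1) T alpha M) /\
        (exists M' : mechanism R (record d.+1) (discrete 'I_d.+1),
           zCDP T rho M' /\ accurate (@err_SumSelect R d.+1) T alpha M').
Proof.
have ln20 := ln2_gt0 R.
(* The factor 2 comes from the selection error, 2 / ln 2 from bounding L by ln T, and sqrt 2 from
   [noise_bound_le]; T >= 6 ensures 6 <= T D. *)
exists (2 * (2 / ln 2) * Num.sqrt 2), 6%N; split.
  by rewrite !mulr_gt0// ?invr_gt0// sqrtr_gt0.
move=> rho d T /andP[rho0 _] T6.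
pose D := d.+1; pose L := (trunc_log 2 T).+1.
pose s := noise_scale rho D L; pose a := noise_bound rho D L T.
have D0 : (0 < D)%N by [].
have L0 : (0 < L)%N by [].
have TL : (T < 2 ^ L)%N by exact: trunc_log_ltn.
have s0 : 0 < s by exact: noise_scale_gt0.
have sn0 : s != 0 by rewrite gt_eqF.
have a0 : 0 <= a by exact: noise_bound_ge0.
have priv : (D * L)%:R / (2 * s ^+ 2) <= rho by rewrite noise_scale_privacy.
have PG := small_noise_prob s0 a0 L0 D0 (noise_bound_tail rho0 D0 L0 T6).
(* Selection requires 2a; the value of the maximum is within a already. *)
exists (2 * a); split; [|split].
- rewrite ger0_norm ?mulr_ge0//.
  have LT : L%:R <= 2 / ln 2 * ln T%:R :> R by apply: trunc_log_le_ln; lia.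
  rewrite [leRHS](_ : _ = 2 * (2 / ln 2 * ln T%:R * (Num.sqrt 2 *
    (Num.sqrt D%:R * Num.sqrt (ln (D * T)%:R)) / Num.sqrt rho))); last by ring.
  rewrite ler_wpM2l//; apply: le_trans; first exact: noise_bound_le.
  by rewrite -!(mulrA L%:R) ler_wpM2r// divr_ge0// mulr_ge0// mulr_ge0.
- exists (tree_mechanism s (@measurable_post_max R L d (T * D))); split.
    exact: tree_mechanism_zCDP.
  apply: tree_mechanism_accurate PG _ => //; first by rewrite mulr_ge0.
    exact: measurable_err_MaxSum.
  move=> xs v va; apply: (@le_trans _ _ a); last by rewrite ler_peMl// ler1n.
  exact: err_MaxSum_select.
- exists (tree_mechanism s (@measurable_post_select R L d (T * D))); split.
    exact: tree_mechanism_zCDP.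
  apply: tree_mechanism_accurate PG _ => //; first by rewrite mulr_ge0.
  by move=> xs v va; exact: err_SumSelect_select.
Qed.
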